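(* Let $(H, G, \alpha, \beta)$ be a matched pair of groups and let $\bigl(X, (\varphi,\psi)\bigr)$ be the pushout in the category of groups of the pair of inclusion morphisms $$\overline{i}: \mathrm{Fix}(H)\times \mathrm{Fix}(G)\hookrightarrow H\ltimes \mathrm{Fix}(G), \qquad \overline{j}: \mathrm{Fix}(H)\times \mathrm{Fix}(G)\hookrightarrow \mathrm{Fix}(H)\rtimes G,$$ with structure morphisms $\varphi:\mathrm{Fix}(H)\rtimes G\to X$ and $\psi:H\ltimes\mathrm{Fix}(G)\to X$ satisfying $\psi\circ\overline{i}=\varphi\circ\overline{j}$. Then the bicrossed product $H\,{}_{\alpha}\!\bowtie_{\beta} G$ is isomorphic to a quotient group of $X$.
   Context: A matched pair of groups $(H,G,\alpha,\beta)$ consists of groups $H$, $G$, a left action $\alpha:G\times H\to H$, $\alpha(g,h)=g\rhd h$, of the group $G$ on the set $H$, and a right action $\beta:G\times H\to G$, $\beta(g,h)=g\lhd h$, of the group $H$ on the set $G$, such that for all $g,g_1,g_2\in G$, $h,h_1,h_2\in H$: $g\rhd(h_1h_2)=(g\rhd h_1)\bigl((g\lhd h_1)\rhd h_2\bigr)$ and $(g_1g_2)\lhd h=\bigl(g_1\lhd(g_2\rhd h)\bigr)(g_2\lhd h)$. The bicrossed product $H\,{}_{\alpha}\!\bowtie_{\beta} G$ is the group on the set $H\times G$ with unit $(1_H,1_G)$ and multiplication $(h_1,g_1)(h_2,g_2)=\bigl(h_1(g_1\rhd h_2),\,(g_1\lhd h_2)g_2\bigr)$. Put $\mathrm{Fix}(H)=\{h\in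 H\mid g\rhd h=h\ \forall g\in G\}$, a subgroup of $H$, and $\mathrm{Fix}(G)=\{g\in G\mid g\lhd h=g\ \forall h\in H\}$, a subgroup of $G$. The group $\mathrm{Fix}(G)$ acts on $H$ from the left by group automorphisms via $\rhd$, and $\mathrm{Fix}(H)$ acts on $G$ from the right by group automorphisms via $\lhd$. $H\ltimes\mathrm{Fix}(G)$ denotes the set $H\times\mathrm{Fix}(G)$ with the semidirect product multiplication $(h,g)(h',g')=(h(g\rhd h'),\,gg')$, and $\mathrm{Fix}(H)\rtimes G$ denotes the set $\mathrm{Fix}(H)\times G$ with the semidirect product multiplication $(h,g)(h',g')=(hh',\,(g\lhd h')g')$. $\mathrm{Fix}(H)\times\mathrm{Fix}(G)$ is the direct product group; the set-theoretic inclusions $\overline{i}$ and $\overline{j}$ are group morphisms. *)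

(* Defs.v *)
From HB Require Import structures.
From mathcomp Require Import all_boot.
From mathcomp Require Import boolp.

Set Implicit Arguments.
Unset Strict Implicit.
Unset Printing Implicit Defensive.

Local Open Scope group_scope.
Local Open Scope quotient_scope.

(* Groups are MathComp's groupType, which may be infinite.  A groupType also
   carries a choiceType structure; classically every group has one. *)

Notation "{ 'gmorph' G -> K }" :=
  (UMagmaMorphism.type G%type K%type)
  (at level 0, G at level 98, K at level 99,
   format "{ 'gmorph'  G  ->  K }") : type_scope.

Definition isomorphic (G K : groupType) : Prop :=
  exists f : {gmorph G -> K}, bijective f.

Record matchedPair (H G : groupType) := MatchedPair {
  lact : G -> H -> H;
  ract : G -> H -> G;
  lact1 : forall h, lact 1 h = h;
  lactM : forall g1 g2 h, lact (g1 * g2) h = lact g1 (lact g2 h);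
  ract1 : forall g, ract g 1 = g;
  ractM : forall g h1 h2, ract g (h1 * h2) = ract (ract g h1) h2;
  lact_mulr : forall g h1 h2,
    lact g (h1 * h2) = lact g h1 * lact (ract g h1) h2;
  ract_mull : forall g1 g2 h,
    ract (g1 * g2) h = ract g1 (lact g2 h) * ract g2 h
}.

Declare Scope matched_scope.
Delimit Scope matched_scope with matched.
Notation "g ▷[ M ] h" := (lact M g h)
  (at level 35, right associativity, format "g  ▷[ M ]  h") : matched_scope.
Notation "g ◁[ M ] h" := (ract M g h)
  (at level 35, no associativity, format "g  ◁[ M ]  h") : matched_scope.
Local Open Scope matched_scope.

Section MatchedPair.
Variables (H G : groupType) (M : matchedPair H G).
Implicit Types (h : H) (g : G).

Lemma lactg1 g : g ▷[M] 1 = 1.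
Proof.
have /(congr1 (fun x => (g ▷[M] 1)^-1 * x)) := lact_mulr M g 1 1.
by rewrite mulg1 ract1 mulKg mulVg.
Qed.

Lemma ract1h h : 1 ◁[M] h = 1.
Proof.
have /(congr1 (fun x => x * (1 ◁[M] h)^-1)) := ract_mull M 1 1 h.
by rewrite mulg1 lact1 mulgK mulgV.
Qed.

Lemma lactVK g h : g^-1 ▷[M] (g ▷[M] h) = h.
Proof. by rewrite -lactM mulVg lact1. Qed.

Lemma lactKV g h : g ▷[M] (g^-1 ▷[M] h) = h.
Proof. by rewrite -lactM mulgV lact1. Qed.

Lemma ractVK g h : (g ◁[M] h^-1) ◁[M] h = g.
Proof. by rewrite -ractM mulVg ract1. Qed.

Lemma ractKV g h : (g ◁[M] h) ◁[M] h^-1 = g.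
Proof. by rewrite -ractM mulgV ract1. Qed.

Definition bicrossed of matchedPair H G : Type := (H * G)%type.
Local Notation B := (bicrossed M).

Definition bicrossed_one : B := (1, 1).
Definition bicrossed_mul (x y : B) : B :=
  (x.1 * (x.2 ▷[M] y.1), (x.2 ◁[M] y.1) * y.2).
(* (h, g) = (h, 1) (1, g), hence (h, g)^-1 = (1, g^-1) (h^-1, 1). *)
Definition bicrossed_inv (x : B) : B :=
  (x.2^-1 ▷[M] x.1^-1, x.2^-1 ◁[M] x.1^-1).

Lemma bicrossed_mulA : associative bicrossed_mul.
Proof.
move=> [h1 g1] [h2 g2] [h3 g3]; rewrite /bicrossed_mul /=; congr pair.
  by rewrite lact_mulr lactM mulgA.
by rewrite ractM ract_mull !mulgA.
Qed.

Lemma bicrossed_mul1 : left_id bicrossed_one bicrossed_mul.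
Proof.
by move=> [h g]; rewrite /bicrossed_mul /= lact1 ract1h !mul1g.
Qed.

Lemma bicrossed_mulr1 : right_id bicrossed_one bicrossed_mul.
Proof.
by move=> [h g]; rewrite /bicrossed_mul /= lactg1 ract1 !mulg1.
Qed.

Lemma bicrossed_mulV : left_inverse bicrossed_one bicrossed_inv bicrossed_mul.
Proof.
move=> [h g]; rewrite /bicrossed_mul /bicrossed_one /=; congr pair.
  by rewrite -lact_mulr mulVg lactg1.
by rewrite ractVK mulVg.
Qed.

Lemma bicrossed_mulrV :
  right_inverse bicrossed_one bicrossed_inv bicrossed_mul.
Proof.
move=> [h g]; rewrite /bicrossed_mul /bicrossed_one /=; congr pair.
  by rewrite lactKV mulgV.
by rewrite -ract_mull mulgV ract1h.
Qed.

HB.instance Definition _ := Choice.copy B (H * G)%type.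
HB.instance Definition _ := isGroup.Build B bicrossed_mulA bicrossed_mul1
  bicrossed_mulr1 bicrossed_mulV bicrossed_mulrV.

(* Fix(H) and Fix(G); [< _ >] makes the predicates boolean (classically), as
   subType requires. *)

Definition fixH : {pred H} := fun h => `[< forall g, g ▷[M] h = h >].
Definition fixG : {pred G} := fun g => `[< forall h, g ◁[M] h = g >].

Lemma fixHP h : reflect (forall g, g ▷[M] h = h) (h \in fixH).
Proof. exact: asboolP. Qed.

Lemma fixGP g : reflect (forall h, g ◁[M] h = g) (g \in fixG).
Proof. exact: asboolP. Qed.

Lemma fixH_group_closed : group_closed fixH.
Proof.
split=> [|h k /fixHP hF /fixHP kF]; apply/fixHP => g; first exact: lactg1.
rewrite lact_mulr hF; congr (_ * _).
apply: (mulgI k); rewrite mulgV.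
have := lact_mulr M (g ◁[M] h ◁[M] k^-1) k k^-1.
by rewrite mulgV lactg1 kF ractVK => <-.
Qed.

Lemma fixG_group_closed : group_closed fixG.
Proof.
split=> [|g k /fixGP gF /fixGP kF]; apply/fixGP => h; first exact: ract1h.
rewrite ract_mull gF; congr (_ * _).
apply: (mulIg k); rewrite mulVg.
have := ract_mull M k^-1 k (k^-1 ▷[M] h).
by rewrite mulVg ract1h kF lactKV => <-.
Qed.

Record fixHType := FixH { fixH_val :> H; _ : fixH_val \in fixH }.
Record fixGType := FixG { fixG_val :> G; _ : fixG_val \in fixG }.

HB.instance Definition _ := [isSub for fixH_val].
HB.instance Definition _ := [Choice of fixHType by <:].
HB.instance Definition _ :=
  SubChoice_isSubGroup.Build H fixH fixHType fixH_group_closed.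

HB.instance Definition _ := [isSub for fixG_val].
HB.instance Definition _ := [Choice of fixGType by <:].
HB.instance Definition _ :=
  SubChoice_isSubGroup.Build G fixG fixGType fixG_group_closed.

Lemma lact_fixH g (h : fixHType) : g ▷[M] h = h.
Proof. by move: g; exact/fixHP/(valP h). Qed.

Lemma ract_fixG (g : fixGType) h : g ◁[M] h = g.
Proof. by move: h; exact/fixGP/(valP g). Qed.

Lemma lact_fixGM (g : fixGType) h1 h2 :
  g ▷[M] (h1 * h2) = (g ▷[M] h1) * (g ▷[M] h2).
Proof. by rewrite lact_mulr ract_fixG. Qed.

Lemma ract_fixHM g1 g2 (h : fixHType) :
  (g1 * g2) ◁[M] h = (g1 ◁[M] h) * (g2 ◁[M] h).
Proof. by rewrite ract_mull lact_fixH. Qed.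

Lemma fixH_valM (x y : fixHType) : fixH_val (x * y) = fixH_val x * fixH_val y.
Proof. exact: (valM (S := fixH)). Qed.

Lemma fixG_valM (x y : fixGType) : fixG_val (x * y) = fixG_val x * fixG_val y.
Proof. exact: (valM (S := fixG)). Qed.

Lemma fixH_val1 : fixH_val 1 = 1.
Proof. exact: (val1 (S := fixH)). Qed.

Lemma fixG_val1 : fixG_val 1 = 1.
Proof. exact: (val1 (S := fixG)). Qed.

Definition ltimesFixG : Type := (H * fixGType)%type.
Local Notation L := ltimesFixG.

Definition ltimes_one : L := (1, 1).
Definition ltimes_mul (x y : L) : L :=
  (x.1 * (x.2 ▷[M] y.1), x.2 * y.2).
Definition ltimes_inv (x : L) : L := (x.2^-1 ▷[M] x.1^-1, x.2^-1).

Lemma ltimes_mulA : associative ltimes_mul.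
Proof.
move=> [h1 g1] [h2 g2] [h3 g3]; rewrite /ltimes_mul /=; congr pair.
  by rewrite lact_fixGM lactM mulgA.
exact: mulgA.
Qed.

Lemma ltimes_mul1 : left_id ltimes_one ltimes_mul.
Proof. by move=> [h g]; rewrite /ltimes_mul /= lact1 !mul1g. Qed.

Lemma ltimes_mulr1 : right_id ltimes_one ltimes_mul.
Proof. by move=> [h g]; rewrite /ltimes_mul /= lactg1 !mulg1. Qed.

Lemma ltimes_mulV : left_inverse ltimes_one ltimes_inv ltimes_mul.
Proof.
move=> [h g]; rewrite /ltimes_mul /ltimes_one /=; congr pair.
  by rewrite -(lact_fixGM g^-1) mulVg lactg1.
exact: mulVg.
Qed.

Lemma ltimes_mulrV : right_inverse ltimes_one ltimes_inv ltimes_mul.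
Proof.
move=> [h g]; rewrite /ltimes_mul /ltimes_one /=; congr pair.
  by rewrite lactKV mulgV.
exact: mulgV.
Qed.

HB.instance Definition _ := Choice.copy L (H * fixGType)%type.
HB.instance Definition _ := isGroup.Build L ltimes_mulA ltimes_mul1
  ltimes_mulr1 ltimes_mulV ltimes_mulrV.

Definition fixHrtimes : Type := (fixHType * G)%type.
Local Notation R := fixHrtimes.

Definition rtimes_one : R := (1, 1).
Definition rtimes_mul (x y : R) : R :=
  (x.1 * y.1, (x.2 ◁[M] y.1) * y.2).
Definition rtimes_inv (x : R) : R := (x.1^-1, x.2^-1 ◁[M] x.1^-1).

Lemma rtimes_mulA : associative rtimes_mul.
Proof.
move=> [h1 g1] [h2 g2] [h3 g3]; rewrite /rtimes_mul /=; congr pair.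
  exact: mulgA.
by rewrite ract_fixHM ractM mulgA.
Qed.

Lemma rtimes_mul1 : left_id rtimes_one rtimes_mul.
Proof. by move=> [h g]; rewrite /rtimes_mul /= ract1h !mul1g. Qed.

Lemma rtimes_mulr1 : right_id rtimes_one rtimes_mul.
Proof. by move=> [h g]; rewrite /rtimes_mul /= ract1 !mulg1. Qed.

Lemma rtimes_mulV : left_inverse rtimes_one rtimes_inv rtimes_mul.
Proof.
move=> [h g]; rewrite /rtimes_mul /rtimes_one /=; congr pair.
  exact: mulVg.
by rewrite ractVK mulVg.
Qed.

Lemma rtimes_mulrV : right_inverse rtimes_one rtimes_inv rtimes_mul.
Proof.
move=> [h g]; rewrite /rtimes_mul /rtimes_one /=; congr pair.
  exact: mulgV.
by rewrite -(ract_fixHM _ _ h^-1) mulgV ract1h.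
Qed.

HB.instance Definition _ := Choice.copy R (fixHType * G)%type.
HB.instance Definition _ := isGroup.Build R rtimes_mulA rtimes_mul1
  rtimes_mulr1 rtimes_mulV rtimes_mulrV.

(* The source carries MathComp's direct product group structure. *)

Definition incl_i (x : fixHType * fixGType) : L := (fixH_val x.1, x.2).
Definition incl_j (x : fixHType * fixGType) : R := (x.1, fixG_val x.2).

Lemma incl_i_morphism : monoid_morphism incl_i.
Proof.
split=> [|[h g] [h' g']].
  by congr pair; exact: fixH_val1.
by congr pair; rewrite /= lact_fixH.
Qed.

Lemma incl_j_morphism : monoid_morphism incl_j.
Proof.
split=> [|[h g] [h' g']].
  by congr pair; exact: fixG_val1.
by congr pair; rewrite /= ract_fixG.
Qed.

HB.instance Definition _ :=
  isUMagmaMorphism.Build (fixHType * fixGType)%type L incl_i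
    incl_i_morphism.
HB.instance Definition _ :=
  isUMagmaMorphism.Build (fixHType * fixGType)%type R incl_j
    incl_j_morphism.

End MatchedPair.

(* (X, (phi, psi)) is a pushout of i : A -> L and j : A -> R in the category
   of groups; phi starts from R and psi from L. *)
Definition is_pushout (A L R X : groupType)
    (i : {gmorph A -> L}) (j : {gmorph A -> R})
    (phi : {gmorph R -> X}) (psi : {gmorph L -> X}) : Prop :=
  psi \o i =1 phi \o j /\
  forall (Y : groupType) (v : {gmorph R -> Y}) (u : {gmorph L -> Y}),
    u \o i =1 v \o j ->
    exists w : {gmorph X -> Y},
      [/\ w \o phi =1 v, w \o psi =1 u
        & forall w' : {gmorph X -> Y},
            w' \o phi =1 v -> w' \o psi =1 u -> w' =1 w].

Record normalSubgroup (X : groupType) := NormalSubgroup {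
  normal_pred :> {pred X};
  normal_group_closed : group_closed normal_pred;
  normal_conj : forall x y, x \in normal_pred -> x ^ y \in normal_pred
}.

Section Quotient.
Variables (X : groupType) (N : normalSubgroup X).
Implicit Types x y : X.

Let N1 : 1 \in N := (normal_group_closed N).1.
Let NV x : x \in N -> x^-1 \in N.
Proof. by move=> Nx; rewrite -div1g; apply: (normal_group_closed N).2. Qed.
Let NM x y : x \in N -> y \in N -> x * y \in N.
Proof.
by move=> Nx Ny; rewrite -[y]invgK; apply: (normal_group_closed N).2 (NV Ny).
Qed.

Definition coset_rel : rel X := fun x y => x^-1 * y \in N.

Lemma coset_rel_equiv : equiv_class_of coset_rel.
Proof.
split=> [x | x y | y x z].
- by rewrite /coset_rel mulVg.
- by apply/idP/idP => /NV; rewrite /coset_rel invgM invgK.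
- rewrite /coset_rel => Nxy Nyz.
  by rewrite -(mulVKg y z) mulgA; apply: NM.
Qed.

Definition coset_equiv := EquivRelPack coset_rel_equiv.
Canonical coset_equiv.
Canonical coset_encMod := defaultEncModRel coset_rel.

Definition quotientGroup : Type := {eq_quot coset_rel}.
Local Notation Q := quotientGroup.

HB.instance Definition _ := Choice.on Q.
HB.instance Definition _ := EqQuotient.on Q.

Lemma cosetE x y : (\pi_Q x = \pi_Q y) <-> (x^-1 * y \in N).
Proof.
by split=> [/eqP | e]; [rewrite piE /= | apply/eqP; rewrite piE /=].
Qed.

Definition quotient_one : Q := \pi_Q 1.
Definition quotient_mul (a b : Q) : Q := \pi_Q (repr a * repr b).
Definition quotient_inv (a : Q) : Q := \pi_Q ((repr a)^-1).

Lemma pi_mulg x y : \pi_Q (x * y) = quotient_mul (\pi_Q x) (\pi_Q y).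
Proof.
apply/cosetE; rewrite invgM.
set x' := repr _; set y' := repr _.
have Nx : x^-1 * x' \in N by apply/cosetE; rewrite reprK.
have Ny : y^-1 * y' \in N by apply/cosetE; rewrite reprK.
suff -> : y^-1 * x^-1 * (x' * y') = (x^-1 * x') ^ y * (y^-1 * y').
  by apply: NM => //; apply: normal_conj.
by rewrite /conjg !mulgA mulgK.
Qed.

Lemma pi_invg x : \pi_Q (x^-1) = quotient_inv (\pi_Q x).
Proof.
apply/cosetE; rewrite invgK; set x' := repr _.
have Nx : x'^-1 * x \in N by apply/cosetE; rewrite reprK.
have -> : x * x'^-1 = (x'^-1 * x) ^ x'^-1.
  by rewrite /conjg invgK !mulgA mulgV mul1g.
exact: normal_conj.
Qed.

Lemma quotient_mulA : associative quotient_mul.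
Proof.
move=> a b c; rewrite -[a]reprK -[b]reprK -[c]reprK.
rewrite -(pi_mulg (repr b) (repr c)) -(pi_mulg (repr a) (repr b)).
by rewrite -(pi_mulg (repr a) _) -(pi_mulg _ (repr c)) mulgA.
Qed.

Lemma quotient_mul1 : left_id quotient_one quotient_mul.
Proof. by move=> a; rewrite -[a]reprK -pi_mulg mul1g. Qed.

Lemma quotient_mulr1 : right_id quotient_one quotient_mul.
Proof. by move=> a; rewrite -[a]reprK -pi_mulg mulg1. Qed.

Lemma quotient_mulV : left_inverse quotient_one quotient_inv quotient_mul.
Proof. by move=> a; rewrite -[a]reprK -pi_invg -pi_mulg mulVg. Qed.

Lemma quotient_mulrV : right_inverse quotient_one quotient_inv quotient_mul.
Proof. by move=> a; rewrite -[a]reprK -pi_invg -pi_mulg mulgV. Qed.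

HB.instance Definition _ := isGroup.Build Q quotient_mulA quotient_mul1
  quotient_mulr1 quotient_mulV quotient_mulrV.

End Quotient.

(* Main.v *)
Require Import Defs.
From HB Require Import structures.
From mathcomp Require Import all_boot.
From mathcomp Require Import boolp.

(** Both semidirect products embed in the bicrossed product [B] by the identity
    on underlying pairs: on [H ⋉ Fix(G)] the right action in the multiplication
    of [B] is trivial, and on [Fix(H) ⋊ G] the left action is.  The two
    embeddings agree on [Fix(H) × Fix(G)], so the universal property of the
    pushout yields a morphism [w : X -> B].  It is onto, because every element
    of [B] factors as (h, g) = (h, 1) (1, g), and each factor lies in the image
    of one of the embeddings.  Hence [B] is isomorphic to [X] modulo the kernel
    of [w], by the first isomorphism theorem ([isomorphic_quotient_kernel]). *)

Set Implicit Arguments.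
Unset Strict Implicit.
Unset Printing Implicit Defensive.

Local Open Scope group_scope.
Local Open Scope quotient_scope.

Section Kernel.
Variables (X Y : groupType) (w : {gmorph X -> Y}).

(** The kernel of [w] as a boolean predicate; [kernel] below packages it as a
    normal subgroup. *)
Definition kernel_pred : {pred X} := fun x => w x == 1.

Lemma mem_kernel x : (x \in kernel_pred) = (w x == 1).
Proof. by []. Qed.

Lemma kernel_group_closed : group_closed kernel_pred.
Proof.
split=> [|x y]; rewrite !mem_kernel ?gmulf1 //.
by move=> /eqP wx /eqP wy; rewrite gmulfF wx wy divg1.
Qed.

Lemma kernel_conj x y : x \in kernel_pred -> x ^ y \in kernel_pred.
Proof. by rewrite !mem_kernel gmulfJ => /eqP ->; rewrite conj1g. Qed.

Definition kernel : normalSubgroup X :=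
  NormalSubgroup kernel_group_closed kernel_conj.

Lemma eq_coset_kernel x y :
  (\pi_(quotientGroup kernel) x = \pi_(quotientGroup kernel) y) <-> w x = w y.
Proof.
rewrite cosetE mem_kernel gmulfM gmulfV.
split=> [/eqP e | ->]; last by rewrite mulVg.
by rewrite -[RHS](mulVKg (w x)) e mulg1.
Qed.

(** Surjectivity of [w] is given by a section [s], which need not be a morphism;
    its composite with the projection onto the quotient always is one. *)
Lemma isomorphic_quotient_kernel (s : Y -> X) :
  cancel s w -> isomorphic Y (quotientGroup kernel).
Proof.
move=> sK; pose f y := \pi_(quotientGroup kernel) (s y).
have fM : monoid_morphism f.
  split=> [|y z].
    by apply/eq_coset_kernel; rewrite sK gmulf1.
  rewrite -[RHS]pi_mulg; apply/eq_coset_kernel.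
  by rewrite gmulfM !sK.
pose fH := isUMagmaMorphism.Build Y (quotientGroup kernel) f fM.
pose F : {gmorph Y -> quotientGroup kernel} := HB.pack f fH.
exists F; exists (fun a => w (repr a)) => [y | a].
  by rewrite -[RHS]sK; apply/eq_coset_kernel; rewrite reprK.
by rewrite -[RHS]reprK; apply/eq_coset_kernel; rewrite sK.
Qed.

End Kernel.

Section Embeddings.
Variables (H G : groupType) (M : matchedPair H G).

(** The inclusion of [H ⋉ Fix(G)] in the bicrossed product. *)
Definition ltimes_bicrossed (x : ltimesFixG M) : bicrossed M :=
  (x.1, fixG_val x.2).

(** The inclusion of [Fix(H) ⋊ G] in the bicrossed product. *)
Definition rtimes_bicrossed (x : fixHrtimes M) : bicrossed M :=
  (fixH_val x.1, x.2).

Lemma ltimes_bicrossed_morphism : monoid_morphism ltimes_bicrossed.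
Proof.
split=> [|[h g] [h' g']]; first by congr pair; exact: fixG_val1.
by congr pair; rewrite /= ract_fixG.
Qed.

Lemma rtimes_bicrossed_morphism : monoid_morphism rtimes_bicrossed.
Proof.
split=> [|[h g] [h' g']]; first by congr pair; exact: fixH_val1.
by congr pair; rewrite /= lact_fixH.
Qed.

HB.instance Definition _ :=
  isUMagmaMorphism.Build (ltimesFixG M) (bicrossed M) ltimes_bicrossed
    ltimes_bicrossed_morphism.
HB.instance Definition _ :=
  isUMagmaMorphism.Build (fixHrtimes M) (bicrossed M) rtimes_bicrossed
    rtimes_bicrossed_morphism.

Lemma bicrossed_factor (h : H) (g : G) :
  ltimes_bicrossed (h, 1) * rtimes_bicrossed (1, g) = (h, g) :> bicrossed M.
Proof.
by congr pair; rewrite /= ?fixG_val1 ?fixH_val1 ?lactg1 ?ract1h ?mulg1 ?mul1g.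
Qed.

End Embeddings.

Theorem proposition1p2 (H G : groupType) (M : matchedPair H G) (X : groupType)
    (phi : {gmorph fixHrtimes M -> X}) (psi : {gmorph ltimesFixG M -> X})
    (hX : is_pushout (@incl_i H G M) (@incl_j H G M) phi psi) :
  exists N : normalSubgroup X, isomorphic (bicrossed M) (quotientGroup N).
Proof.
have [_ univ] := hX.
(* The two embeddings agree on [Fix(H) × Fix(G)] by computation. *)
have [|w [wphi wpsi _]] :=
  univ (bicrossed M) (@rtimes_bicrossed H G M) (@ltimes_bicrossed H G M).
  by [].
exists (kernel w).
pose s (b : bicrossed M) : X := psi (b.1, 1) * phi (1, b.2).
apply: (@isomorphic_quotient_kernel _ _ w s) => -[h g].
rewrite /s gmulfM -[w (psi _)]/((w \o psi) _) -[w (phi _)]/((w \o phi) _).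
by rewrite wpsi wphi; exact: bicrossed_factor.
Qed.
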